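(* Let $M\ge 2$ be an integer and let $F\colon X\to X$ be the twisted baker map on $X=[-1,1]\times[0,1]^{M-1}$. Then: (a) All periodic points in $\bigcup_{n=1}^\infty \mathrm{fix}(n)$ are hyperbolic repelling. (b) Both $\bigcup_{n=1}^\infty \mathrm{fix}_{\mathbb R}(n)$ and $\bigcup_{n=1}^\infty \mathrm{fix}_{\mathbb C}(n)$ are dense in $X$.
   Context: Let $M\ge2$ be an integer and $X=\{(x_1,\ldots,x_M)\in\mathbb R^M\colon -1\le x_1\le 1,\ 0\le x_j\le 1 \text{ for } j=2,\ldots,M\}$. Put $X_L=\{x\in X\colon x_1<0\}$ and $X_R=\{x\in X\colon x_1\ge 0\}$. The twisted baker map $F\colon X\to X$ is $$F(x_1,\ldots,x_M)=\begin{cases}(1+2x_1,x_2,\ldots,x_M) & \text{on } X_L,\\ (1-2x_M,x_1,\ldots,x_{M-1}) & \text{on } X_R.\end{cases}$$ Let $N=\{x\in X\colon x_1=-1\}$ (its points are fixed by $F$). A periodic point of $F$ of period $n$ means a fixed point of $F^n$ ($n$ need not be the minimal period). $JF^n(x)$ denotes the Jacobian matrix of $F^n$ at $x\in X$ with respect to the canonical basis of $\mathbb R^M$, and $\mathrm{spec}(JF^n(x))$ its set of (complex) eigenvalues. At boundary points of $X_L$ or $X_R$ derivatives are understood as one-sided derivatives: $JF(x)$ is the matrix of the linear part of the affine map defining $F$ on whichever of $X_L,X_R$ contains $x$, and $JF^n(x)=JF(F^{n-1}(x))\cdots JF(F(x))JF(x)$. A periodic point $x$ of period $n\ge1$ is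 hyperbolic repelling if $\mathrm{spec}(JF^n(x))$ does not intersect the closed unit disk $\{z\in\mathbb C\colon |z|\le 1\}$. For $n\ge1$ define $\mathrm{fix}(n)=\{x\in X\setminus N\colon F^n(x)=x\}$, $\mathrm{fix}_{\mathbb R}(n)=\{x\in\mathrm{fix}(n)\colon \mathrm{spec}(JF^n(x))\subset\mathbb R\}$, $\mathrm{fix}_{\mathbb C}(n)=\{x\in\mathrm{fix}(n)\colon \mathrm{spec}(JF^n(x))\not\subset\mathbb R\}$. *)

(* Defs.v *)
From HB Require Import structures.
From mathcomp Require Import all_boot all_order all_algebra.
From mathcomp Require Import all_classical all_reals all_analysis.
From mathcomp Require Import complex.
From mathcomp Require Import ring lra.
Set Implicit Arguments.
Unset Strict Implicit.
Unset Printing Implicit Defensive.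
Import Order.TTheory GRing.Theory Num.Theory.
Import numFieldNormedType.Exports.
Local Open Scope classical_set_scope.
Local Open Scope ring_scope.
Local Open Scope complex_scope.

(* The dimension is M = m.+2, so that m ranges over nat exactly when M ranges
   over the integers M >= 2.  Points are column vectors indexed from 0: the
   coordinate x_j is x (j-1) 0; thus x_1 is [x ord0 0] and x_M is [x ord_max 0]. *)
Section TwistedBaker.
Variables (R : realType) (m : nat).
Implicit Types (x : 'cV[R]_m.+2) (g : 'cV[R]_m.+2 -> 'cV[R]_m.+2) (n : nat).

Definition X : set 'cV[R]_m.+2 :=
  [set x | -1 <= x ord0 0 <= 1 /\
           forall j : 'I_m.+2, j != ord0 -> 0 <= x j 0 <= 1].

Definition XL : set 'cV[R]_m.+2 := [set x | X x /\ x ord0 0 < 0].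

Definition XR : set 'cV[R]_m.+2 := [set x | X x /\ 0 <= x ord0 0].

Definition N : set 'cV[R]_m.+2 := [set x | X x /\ x ord0 0 = -1].

Definition bakerL x : 'cV[R]_m.+2 :=
  \col_i (if i == ord0 then 1 + 2 * x ord0 0 else x i 0).

Definition bakerR x : 'cV[R]_m.+2 :=
  \col_i (if i == ord0 then 1 - 2 * x ord_max 0 else x (inord i.-1) 0).

(* The map is total on the ambient space; only its values on X matter, where
   [baker_XL] and [baker_XR] give the two branches and [baker_X] the
   invariance of X. *)
Definition baker x : 'cV[R]_m.+2 :=
  if x ord0 0 < 0 then bakerL x else bakerR x.

Lemma baker_XL x : XL x -> baker x = bakerL x.
Proof. by rewrite /baker => -[_ ->]. Qed.

Lemma baker_XR x : XR x -> baker x = bakerR x.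
Proof. by rewrite /baker => -[_]; rewrite leNgt => /negbTE ->. Qed.

Lemma baker_X x : X x -> X (baker x).
Proof.
move=> [x0 xj]; rewrite /baker; case: ltP => hx; split => /=.
- by rewrite mxE eqxx; lra.
- by move=> j j0; rewrite mxE (negbTE j0); exact: xj.
- by rewrite mxE eqxx; have := xj ord_max isT; lra.
move=> j j0; rewrite mxE (negbTE j0).
have [->|k0] := eqVneq (inord j.-1 : 'I_m.+2) ord0; last exact: xj.
by move/andP: x0 => [_ ->]; rewrite hx.
Qed.

(* Matrix, in the canonical basis, of the linear part of an affine map g: its
   j-th column is g(e_j) - g(0). *)
Definition linear_part g : 'M[R]_m.+2 :=
  \matrix_(i, j) (g (delta_mx j 0) i 0 - g 0 i 0).

Lemma bakerL_affine x : bakerL x = linear_part bakerL *m x + bakerL 0.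
Proof.
apply/colP => i; rewrite !mxE; have [->|i0] := eqVneq i ord0.
  rewrite (bigD1 ord0) //= big1 ?addr0; last first.
    by move=> k k0; rewrite !mxE /= (eq_sym _ k) (negbTE k0) /=; ring.
  by rewrite !mxE /=; ring.
rewrite (bigD1 i) //= big1 ?addr0; last first.
  move=> k k0; rewrite !mxE (negbTE i0) (eq_sym _ k) (negbTE k0) /=; ring.
by rewrite !mxE (negbTE i0) eqxx /=; ring.
Qed.

Lemma bakerR_affine x : bakerR x = linear_part bakerR *m x + bakerR 0.
Proof.
apply/colP => i; rewrite !mxE; have [->|i0] := eqVneq i ord0.
  rewrite (bigD1 ord_max) //= big1 ?addr0; last first.
    by move=> k k0; rewrite !mxE eqxx (eq_sym _ k) (negbTE k0) /=; ring.
  by rewrite !mxE !eqxx /=; ring.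
rewrite (bigD1 (inord i.-1)) //= big1 ?addr0; last first.
  move=> k k0; rewrite !mxE (negbTE i0) (eq_sym _ k) (negbTE k0) /=; ring.
by rewrite !mxE (negbTE i0) eqxx /=; ring.
Qed.

Definition JF x : 'M[R]_m.+2 :=
  if x ord0 0 < 0 then linear_part bakerL else linear_part bakerR.

(* JF^n(x) = JF(F^(n-1)(x)) ... JF(F(x)) JF(x). *)
Fixpoint JFn n x : 'M[R]_m.+2 :=
  if n is k.+1 then JF (iter k baker x) *m JFn k x else 1%:M.

(* [eigenvalue] is phrased with left eigenvectors, which have the same
   eigenvalues as right ones. *)
Definition spec (A : 'M[R]_m.+2) : set R[i] :=
  [set z | eigenvalue (map_mx (real_complex R) A) z].

Definition real_line : set R[i] := [set z | complex.Im z = 0].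

Definition closed_unit_disk : set R[i] := [set z | `|z| <= 1].

Definition hyperbolic_repelling n x : Prop :=
  spec (JFn n x) `&` closed_unit_disk = set0.

Definition fix_ n : set 'cV[R]_m.+2 :=
  [set x | (X `\` N) x /\ iter n baker x = x].

Definition fixR n : set 'cV[R]_m.+2 :=
  [set x | fix_ n x /\ spec (JFn n x) `<=` real_line].

Definition fixC n : set 'cV[R]_m.+2 :=
  [set x | fix_ n x /\ ~ (spec (JFn n x) `<=` real_line)].

(* The closure is taken in R^M with the (sup-norm) topology of matrices; for
   A contained in X this is density in the subspace X. *)
Definition dense_in_X (A : set 'cV[R]_m.+2) : Prop := X `<=` closure A.

End TwistedBaker.

(* Main.v *)
(* A point of X_R has last coordinate t, enters the doubling zone as 1 - 2t and
   comes back to X_R after k doublings.  The first return map to X_R, which up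
   to the fixed set N is [0,1]^M, is therefore (x_1, .., x_M) |->
   (g(x_M), x_1, .., x_{M-1}) for a one-dimensional expanding map g with
   countably many full branches.  Consequently JF^n(x) is a cyclic shift by p
   with nonzero weights, p being the number of visits to X_R before time n; the
   product of the weights is (-1)^p 2^n, and every weight has modulus at least
   2 as soon as p >= M.

   (a) A period n outside N has p >= 1, so JF^(nM) is diagonal with entries of
   modulus at least 2, and its entries include the M-th powers of the
   eigenvalues of JF^n.

   (b) Composing p inverse branches of the return map, chosen along the orbit
   of a given point, gives a contraction of [0,1]^M (once p >= M) with image
   close to that point; its fixed point is periodic for F.  If M divides p the
   Jacobian is diagonal, so its spectrum is real.  If p = 1 mod M and p is odd
   the Jacobian is a full cycle whose eigenvalues are the M-th roots of the
   negative number -2^n, one of which has argument pi / M.  Finally F maps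
   [0,1]^M onto X, which transfers density from [0,1]^M to X. *)
Require Import Defs.
From HB Require Import structures.
From mathcomp Require Import all_boot all_order all_algebra.
From mathcomp Require Import all_classical all_reals all_analysis.
From mathcomp Require Import complex ring lra zify.
Set Implicit Arguments.
Unset Strict Implicit.
Unset Printing Implicit Defensive.
Import Order.TTheory GRing.Theory Num.Theory.
Import numFieldNormedType.Exports.
Local Open Scope classical_set_scope.
Local Open Scope ring_scope.
Local Open Scope complex_scope.

(** * Cyclic index arithmetic and weighted cyclic shifts *)

Lemma ord_addr1 m (j : 'I_m.+2) :
  j != ord_max -> (j + 1 : 'I_m.+2) = j.+1 :> nat.
Proof.
move=> jm; rewrite /= (@modn_small 1) // addn1 modn_small // ltnS ltn_neqAle.
by rewrite -ltnS ltn_ord andbT; apply: contra jm => /eqP jE; apply/eqP/val_inj.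
Qed.

Lemma ord_max_addr1 m : (ord_max + 1 : 'I_m.+2) = 0.
Proof. by apply/val_inj; rewrite /= (@modn_small 1) // addn1 modnn. Qed.

Section WeightedShift.
Variables (m : nat).
Implicit Types (a b i j : 'I_m.+2).

(** Addition in ['I_m.+2] is that of Z/M, so the shift [a] is automatically taken mod M. *)
Definition wshift (T : nzRingType) a (w : 'I_m.+2 -> T) : 'M[T]_m.+2 :=
  \matrix_(i, j) (w i *+ (j == i - a)).

Lemma wshift_id (T : nzRingType) : 1%:M = wshift 0 (fun=> 1 : T).
Proof. by apply/matrixP => i j; rewrite !mxE subr0 eq_sym. Qed.

Lemma mul_wshift (T : nzRingType) a b (w v : 'I_m.+2 -> T) :
  wshift a w *m wshift b v = wshift (a + b) (fun i => w i * v (i - a)).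
Proof.
apply/matrixP => i j; rewrite !mxE (bigD1 (i - a)) //= big1 => [|k ka].
  by rewrite !mxE eqxx mulr1n addr0 opprD addrA mulrnAr.
by rewrite !mxE (negbTE ka) mulr0n mul0r.
Qed.

Lemma row_mul_wshift (T : nzRingType) (u : 'rV[T]_m.+2) a w j :
  (u *m wshift a w) 0 j = u 0 (j + a) * w (j + a).
Proof.
rewrite mxE (bigD1 (j + a)) //= big1 => [|k ka].
  by rewrite !mxE addrK eqxx addr0.
rewrite !mxE; case: eqP => [jE|]; last by rewrite mulr0n mulr0.
by rewrite jE subrK eqxx in ka.
Qed.

Lemma map_wshift (T S : nzRingType) (f : {rmorphism T -> S}) a w :
  map_mx f (wshift a w) = wshift a (f \o w).
Proof. by apply/matrixP => i j; rewrite !mxE rmorphMn. Qed.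

Lemma eigenvalue_wshift0 (F : fieldType) (w : 'I_m.+2 -> F) z :
  eigenvalue (wshift 0 w) z -> exists i, z = w i.
Proof.
case/eigenvalueP => v vA /rV0Pn[i vi0]; exists i.
have /rowP/(_ i) := vA; rewrite row_mul_wshift addr0 !mxE.
by rewrite mulrC => /(mulIf vi0) ->.
Qed.

(** The left eigenvector has entries z^j / (w_1 ... w_j); the condition on z^M closes the cycle at
    the last index. *)
Lemma eigenvalue_wshift1 (F : fieldType) (w : 'I_m.+2 -> F) z :
  (forall i, w i != 0) -> z ^+ m.+2 = \prod_i w i -> eigenvalue (wshift 1 w) z.
Proof.
move=> w0 zE; pose c (j : nat) := \prod_(1 <= k < j.+1) w (inord k).
have c0 j : c j != 0.
  by rewrite prodf_seq_neq0; apply/allP => k _; rewrite w0.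
apply/eigenvalueP; exists (\row_j (z ^+ j / c j)); last first.
  apply/rV0Pn; exists 0; rewrite mxE expr0 mul1r invr_eq0; exact: c0.
apply/rowP => j; rewrite row_mul_wshift !mxE.
have [->|jm] := eqVneq j ord_max.
  rewrite ord_max_addr1 expr0 /c big_geq // invr1 !mul1r /= mulrA -exprS zE.
  rewrite (big_ord_recl m.+1) /= -mulrA -[LHS]mulr1; congr (_ * _).
  rewrite big_add1 big_mkord /=; apply/esym.
  have -> : \prod_(k < m.+1) w (inord k.+1) = \prod_(k < m.+1) w (lift ord0 k).
    apply: eq_bigr => k _; congr w; apply/val_inj.
    by rewrite /= inordK // ltnS ltn_ord.
  by rewrite mulfV //; apply/prodf_neq0 => k _; exact: w0.
rewrite (ord_addr1 jm) {1}/c big_nat_recr //= -/(c j).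
have -> : inord j.+1 = j + 1.
  by apply/val_inj; rewrite -(ord_addr1 jm) inord_val.
rewrite exprS invfM mulrA [_ / c j]mulrC.
have := c0 j; have := w0 (j + 1); move: (w _) (c j) => x y x0 y0; field.
by rewrite x0 y0.
Qed.

End WeightedShift.

(** * The Jacobian of an iterate as a weighted shift *)

Section Jacobian.
Variables (R : realType) (m : nat).
Implicit Types (x : 'cV[R]_m.+2) (n : nat) (i j : 'I_m.+2).

Definition rcount n x : nat :=
  \sum_(k < n) (0 <= iter k (@baker R m) x ord0 0)%R.

Lemma rcountD a b x :
  rcount (a + b) x = (rcount a x + rcount b (iter a (@baker R m) x))%N.
Proof.
rewrite /rcount big_split_ord /=; congr (_ + _)%N.
by apply: eq_bigr => k _; rewrite addnC iterD.
Qed.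

Lemma rcountM k n x : iter n (@baker R m) x = x ->
  rcount (k * n) x = (k * rcount n x)%N.
Proof.
move=> xn; elim: k => [|k IH]; first by rewrite !mul0n /rcount big_ord0.
by rewrite !mulSn rcountD xn IH.
Qed.

Lemma JFnD a b x : JFn (a + b) x = JFn a (iter b (@baker R m) x) *m JFn b x.
Proof.
elim: a => [|a IH] /=; first by rewrite mul1mx.
by rewrite IH mulmxA iterD.
Qed.

Lemma ord_subr1 i : i != 0 -> inord i.-1 = i - 1.
Proof.
move=> i0; apply/(@addIr _ 1); rewrite subrK; apply/ord_inj.
have i_gt0 : (0 < i)%N.
  by rewrite lt0n; apply: contra i0 => /eqP iE; apply/eqP/val_inj.
have iE : (inord i.-1 : 'I_m.+2) = i.-1 :> nat.
  by rewrite inordK // prednK // ltnW.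
rewrite ord_addr1 ?iE ?prednK //; apply/eqP => /(congr1 val) /=.
by rewrite iE; have := ltn_ord i; lia.
Qed.

Lemma linear_part_bakerL : linear_part (@bakerL R m) =
  wshift 0 (fun i => if i == 0 then 2 else 1).
Proof.
apply/matrixP => i j; rewrite !mxE subr0 -[0 : 'I_m.+2]/(ord0).
have [->|i0] := eqVneq i ord0.
  by rewrite (eq_sym j) !andbT; case: eqP => _ /=; ring.
by rewrite !andbT eq_sym; case: eqP => _ /=; ring.
Qed.

Lemma linear_part_bakerR : linear_part (@bakerR R m) =
  wshift 1 (fun i => if i == 0 then -2 else 1).
Proof.
apply/matrixP => i j; rewrite !mxE.
have [->|i0] := eqVneq i 0.
  have -> : 0 - 1 = ord_max :> 'I_m.+2 by rewrite -(ord_max_addr1 m) addrK.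
  by rewrite eqxx !andbT (eq_sym j); case: eqP => _ /=; ring.
by rewrite ord_subr1 // !andbT eq_sym; case: eqP => _ /=; ring.
Qed.

(** A left step doubles weight 0. A right step rotates the weights by one place and multiplies the
    new weight 0 by -2, so after p right steps each index below p carries such a factor. *)
Lemma JFn_wshift n x : exists w : 'I_m.+2 -> R,
  [/\ JFn n x = wshift (rcount n x)%:R w, forall i, 1 <= `|w i|,
      forall i, (i < rcount n x)%N -> 2 <= `|w i| &
      \prod_i w i = (-1) ^+ rcount n x * 2 ^+ n].
Proof.
elim: n => [|n [w [JE w1 w2 wP]]].
  exists (fun=> 1); rewrite /rcount big_ord0 /= wshift_id.
  by split=> // [i|]; rewrite ?normr1// big1_eq mulr1.
have -> : rcount n.+1 x =
    (rcount n x + (0 <= iter n (@baker R m) x ord0 ord0)%R)%N.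
  by rewrite /rcount big_ord_recr.
rewrite /= JE /JF.
case: ltP => _ /=.
  rewrite addn0 linear_part_bakerL mul_wshift add0r.
  exists (fun i => (if i == 0 then 2 else 1) * w (i - 0)); split=> //.
  - move=> i; rewrite subr0 normrM; have := w1 i.
    by case: eqP => _; rewrite ?normr_nat ?normr1; lra.
  - move=> i /w2; rewrite subr0 normrM.
    by case: eqP => _; rewrite ?normr_nat ?normr1; lra.
  rewrite big_split /= (bigD1 0) //= big1 ?mulr1 => [|i /negbTE -> //].
  by under eq_bigr do rewrite subr0; rewrite wP exprS; ring.
rewrite addn1 linear_part_bakerR mul_wshift -(@nat1r _ (rcount n x)).
exists (fun i => (if i == 0 then -2 else 1) * w (i - 1)); split=> //.
- move=> i; rewrite normrM; have := w1 (i - 1).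
  by case: eqP => _; rewrite ?normrN ?normr_nat ?normr1; lra.
- move=> i ip; rewrite normrM; case: eqP => [_|/eqP i0].
    by rewrite normrN normr_nat; have := w1 (i - 1); lra.
  rewrite normr1 mul1r; apply: w2; rewrite -ord_subr1 // inordK; last first.
    by have := ltn_ord i; lia.
  suff : (0 < i)%N by lia.
  by rewrite lt0n; apply: contra i0 => /eqP iE; apply/eqP/ord_inj.
rewrite big_split /= (bigD1 0) //= big1 ?mulr1 => [|i /negbTE -> //].
rewrite (reindex_inj (@addIr _ 1)) /=; under eq_bigr do rewrite addrK.
by rewrite wP !exprS; ring.
Qed.

End Jacobian.

(** * Spectrum at periodic points *)

Lemma ord_natr_order m : m.+2%:R = 0 :> 'I_m.+2.
Proof. by rewrite Zp_nat; apply/val_inj; rewrite /= modnn. Qed.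

Section Spectrum.
Variables (R : realType) (m : nat).
Implicit Types (x : 'cV[R]_m.+2) (n : nat) (i j : 'I_m.+2).

Lemma eigenvalue_JFnM x n k z : iter n (@baker R m) x = x ->
  spec (JFn n x) z -> spec (JFn (k * n) x) (z ^+ k).
Proof.
move=> xn /eigenvalueP[v vJ v0]; apply/eigenvalueP; exists v => //.
elim: k => [|k IH]; first by rewrite /= map_mx1 mulmx1 scale1r.
by rewrite mulSnr JFnD xn map_mxM mulmxA IH -scalemxAl vJ scalerA exprSr.
Qed.

(** Without a visit to X_R every step doubles x_1 + 1, and periodicity then forces x_1 = -1. *)
Lemma fix_rcount_gt0 x n : (0 < n)%N -> fix_ n x -> (0 < rcount n x)%N.
Proof.
move=> n0 [[Xx Nx] xn]; rewrite lt0n; apply/eqP => r0; apply: Nx; split=> //.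
suff run k : (k <= n)%N ->
    iter k (@baker R m) x ord0 ord0 + 1 = 2 ^+ k * (x ord0 ord0 + 1).
  have := run n (leqnn n); rewrite xn => /eqP.
  rewrite -subr_eq0 -[X in X - _]mul1r -mulrBl mulf_eq0 subr_eq0 addr_eq0.
  by rewrite lt_eqF ?exprn_egt1 ?ltr1n -?lt0n //= => /eqP.
elim: k => [|k IH] kn; first by rewrite mul1r.
have xk : iter k (@baker R m) x ord0 ord0 < 0.
  rewrite ltNge; apply/negP => xk; move: r0 => /eqP.
  by rewrite /rcount (bigD1 (Ordinal kn)) //= xk.
rewrite exprS -mulrA -IH ?(ltnW kn) // iterS.
move: (iter k _ x) xk => y y0; rewrite /baker y0 mxE eqxx.
by move: (y _ _) => t; ring.
Qed.

Lemma fix_hyperbolic_repelling n x :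
  (0 < n)%N -> fix_ n x -> hyperbolic_repelling n x.
Proof.
move=> n0 xn; have r0 := fix_rcount_gt0 n0 xn; case: xn => _ xn.
apply/seteqP; split=> // z [/(eigenvalue_JFnM m.+2 xn)].
have [w [-> _ w2 _]] := JFn_wshift (m.+2 * n) x.
rewrite rcountM // natrM ord_natr_order ?mul0r.
rewrite /spec /= map_wshift => /eigenvalue_wshift0[i zi] z1.
have : `|z ^+ m.+2| <= 1 by rewrite normrX exprn_ile1.
rewrite zi /= normc_def /= expr0n addr0 sqrtr_sqr lecR => wi.
(* At least one visit per period gives at least M visits in M periods, so the bound 2 holds at every
   index. *)
have := w2 i; rewrite rcountM // (leq_trans (ltn_ord i)) ?leq_pmulr //.
by move=> /(_ isT); lra.
Qed.

Lemma spec_real n x p : rcount n x = (p * m.+2)%N ->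
  spec (JFn n x) `<=` @real_line R.
Proof.
move=> rE z; have [w [-> _ _ _]] := JFn_wshift n x.
rewrite rE natrM ord_natr_order ?mulr0.
by rewrite /spec /= map_wshift => /eigenvalue_wshift0[i ->].
Qed.

Definition cis (t : R) : R[i] := cos t +i* sin t.

Lemma cisX t k : cis t ^+ k = cis (t *+ k).
Proof.
elim: k => [|k IH]; first by rewrite /cis mulr0n cos0 sin0.
rewrite exprS IH mulrS /cis cosD sinD; apply/eqP; rewrite eq_complex /=.
by rewrite !eqxx /= addrC.
Qed.

(** The doubled [p] makes the number of visits odd whatever the parity of M. *)
Lemma spec_nonreal n x p : rcount n x = (p.*2 * m.+2).+1 ->
  ~ (spec (JFn n x) `<=` @real_line R).
Proof.
move=> rE; have [w [-> w1 _ wP]] := JFn_wshift n x.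
rewrite rE -natr1 natrM ord_natr_order ?mulr0 ?add0r.
pose r : R := 2 `^ (n%:R / m.+2%:R); pose t : R := pi / m.+2%:R.
have rM : r ^+ m.+2 = 2 ^+ n.
  by rewrite -powR_mulrn ?powR_ge0 // -powRrM divfK ?pnatr_eq0 // powR_mulrn.
have tM : t *+ m.+2 = pi by rewrite -mulr_natr divfK ?pnatr_eq0.
have wN : \prod_i w i = - 2 ^+ n.
  by rewrite wP rE exprS -doubleMl -mul2n exprM sqrrN !expr1n mulr1 mulN1r.
have zM : (r%:C * cis t) ^+ m.+2 = \prod_i (w i)%:C.
  rewrite exprMn cisX -rmorphXn rM tM -rmorph_prod wN /cis cospi sinpi.
  by rewrite rmorphN -[_ +i* 0]/((-1)%:C) rmorphN1 mulrN1.
move=> /(_ (r%:C * cis t)); rewrite /spec /= map_wshift => /(_ _)/wrap[].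
  apply: eigenvalue_wshift1 => // i /=.
  by rewrite fmorph_eq0 -normr_gt0 (lt_le_trans _ (w1 i)).
rewrite /real_line /= mul0r addr0 => /eqP; apply/negP.
rewrite mulf_neq0 ?gt_eqF ?powR_gt0 // sin_gt0_pi // /t divr_gt0 ?pi_gt0 //=.
by rewrite ltr_pdivrMr // ltr_pMr ?pi_gt0 // ltr1n.
Qed.

End Spectrum.

(* Matrices already are complete and normed; redeclaring completeness makes
   their join [completeNormedModType] inferable. *)
HB.instance Definition _ (R : realType) (m n : nat) :=
  Uniform_isComplete.Build 'M[R]_(m.+1, n.+1) cauchy_cvg.

(** * Inverse branches of the first return map and their fixed points *)

Section InverseBranches.
Variables (R : realType) (m : nat).
Implicit Types (x y z : 'cV[R]_m.+2) (i j : 'I_m.+2) (k n : nat) (s : seq nat).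
Local Notation M := m.+2.

Definition cube : set 'cV[R]_M := [set z | forall i, 0 <= z i 0 <= 1].

(* Inverse of the k-th branch t |-> 2^(k+1) (1 - t) - 1 of g. *)
Definition branch k (t : R) : R := 1 - (t + 1) / 2 ^+ k.+1.

Definition Binv k x : 'cV[R]_M :=
  \col_i (if i == ord_max then branch k (x 0 0) else x (i + 1) 0).

(** The head of [s] is applied last, hence is the first branch met by the forward orbit. *)
Definition Binvs s x := foldr Binv x s.

Lemma pow2_ge1 k : 1 <= 2 ^+ k :> R.
Proof. by rewrite exprn_ege1 // ler1n. Qed.

Lemma branch_itv k t : 0 <= t <= 1 -> 0 <= branch k t < 1.
Proof.
move=> t01; rewrite /branch; have := pow2_ge1 k; rewrite exprS.
move: (2 ^+ k) => a a1.
have a0 : 0 < 2 * a by lra.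
rewrite subr_ge0 ler_pdivrMr // gtrBl divr_gt0 //; lra.
Qed.

Lemma branch_contract k t u : `|branch k t - branch k u| <= `|t - u| * 2^-1.
Proof.
have -> : branch k t - branch k u = (u - t) * (2 ^+ k.+1)^-1.
  by rewrite /branch; ring.
rewrite normrM distrC ler_wpM2l // ger0_norm ?invr_ge0 ?exprn_ge0 //.
by rewrite lef_pV2 ?posrE ?exprn_gt0 // ler_eXnr // ler1n.
Qed.

(* When t = 1 no branch of g is defined at t, but the images of the branches
   accumulate there. *)
Lemma branch_dense t d : 0 <= t <= 1 -> exists k u, 0 <= u <= 1 /\
  forall v, 0 <= v <= 1 -> `|v - u| <= 2^-1 ^+ d ->
  `|branch k v - t| <= 2^-1 ^+ d.+1.
Proof.
move=> /andP[t0]; rewrite le_eqVlt => /predU1P[->|t1].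
  exists d.+1, 0; split=> [|v v01 _]; first by lra.
  rewrite /branch addrAC subrr add0r normrN ger0_norm; last first.
    by rewrite divr_ge0 ?exprn_ge0 //; lra.
  rewrite exprS invfM mulrA exprVn ler_piMl ?invr_ge0 ?exprn_ge0 //; lra.
(* This [k] satisfies 1 - 2^-k <= t <= 1 - 2^-(k+1), and [u] will be the value at t of the [k]-th
   branch of g. *)
have [k tk tk'] : exists2 k, 1 <= 2 ^+ k.+1 * (1 - t) & 2 ^+ k * (1 - t) <= 1.
  have exk : exists k, 1 <= 2 ^+ k.+1 * (1 - t).
    exists (Num.bound (1 - t)^-1).
    rewrite -ler_pdivrMr ?subr_gt0 // mul1r exprS.
    have := upper_nthrootP (leqnn (Num.bound (1 - t)^-1)).
    by have := pow2_ge1 (Num.bound (1 - t)^-1); lra.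
  case: (ex_minnP exk) => -[|k] kP kmin;
    [exists 0%N|exists k.+1] => //; first lra.
  by rewrite leNgt; apply/negP => /ltW/kmin; rewrite ltnn.
exists k, (2 ^+ k.+1 * (1 - t) - 1); split.
  by move: tk tk'; rewrite exprS; lra.
move=> v v01 vu; have {1}-> : t = branch k (2 ^+ k.+1 * (1 - t) - 1).
  by rewrite /branch subrK mulrAC mulfV ?expf_neq0 // mul1r subKr.
by rewrite (le_trans (branch_contract _ _ _)) // [leRHS]exprSr ler_wpM2r.
Qed.

Lemma Binv_cube k x : cube x -> cube (Binv k x).
Proof.
move=> xc i; rewrite mxE; case: eqP => // _.
by have /andP[-> /ltW ->] := branch_itv k (xc 0).
Qed.

Lemma Binvs_cube s x : cube x -> cube (Binvs s x).
Proof. by move=> xc; elim: s => //= k s; exact: Binv_cube. Qed.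

(** Such a coordinate has passed through some [branch], whose values stay below 1. *)
Lemma Binvs_lt1 s x i : cube x -> (M <= size s + i)%N -> Binvs s x i 0 < 1.
Proof.
move=> xc; elim: s i => [|k s IH] i /=; first by rewrite add0n leqNgt ltn_ord.
rewrite mxE; case: eqP => [_ _|/eqP im si].
  by have /andP[] := branch_itv k (Binvs_cube s xc 0).
by apply: IH; rewrite ord_addr1 // addnS.
Qed.

(* p steps pass coordinate i (from 0) through floor((p + i) / M) branches. *)
Lemma Binvs_contract s x y (d : R) : (forall i, `|x i 0 - y i 0| <= d) ->
  forall i, `|Binvs s x i 0 - Binvs s y i 0| <= d * 2^-1 ^+ ((size s + i) %/ M).
Proof.
move=> xy; elim: s => [|k s IH] i /=.
  by rewrite divn_small ?mulr1 // ltn_ord.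
rewrite !mxE; case: eqP => [->|/eqP im].
  rewrite (le_trans (branch_contract _ _ _)) //.
  rewrite /= addSnnS divnDr // divnn /= addn1 exprSr mulrA ler_wpM2r //.
  by have := IH 0; rewrite /= addn0.
by rewrite addSnnS -ord_addr1.
Qed.

Lemma Binvs_dense p x : cube x -> exists2 s, size s = p &
  forall z, cube z ->
  forall i, `|Binvs s z i 0 - x i 0| <= 2^-1 ^+ ((p + i) %/ M).
Proof.
elim: p x => [|p IH] x xc.
  exists [::] => // z zc i; rewrite divn_small ?ltn_ord //= expr0.
  by have := zc i; have := xc i; rewrite ler_norml; lra.
have [k [u [u01 uP]]] := branch_dense (p %/ M) (xc ord_max).
(* The next target is [x] moved by the return map, with [u] standing for g(x_M), which need not
   exist. *)
pose y : 'cV[R]_M := \col_i (if i == 0 then u else x (i - 1) 0).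
have [s sp sP] : exists2 s, size s = p &
  forall z, cube z ->
  forall i, `|Binvs s z i 0 - y i 0| <= 2^-1 ^+ ((p + i) %/ M).
  by apply: IH => i; rewrite mxE; case: eqP.
exists (k :: s) => [|z zc i]; rewrite /= ?sp // mxE; case: eqP => [->|/eqP im].
  rewrite /= addSnnS divnDr // divnn /= addn1.
  apply: uP; first exact: Binvs_cube.
  by have := sP z zc 0; rewrite mxE eqxx addn0.
have i1 : (i + 1 == 0) = false.
  by apply/eqP => /(congr1 (@nat_of_ord _)); rewrite ord_addr1.
by have := sP z zc (i + 1); rewrite mxE addrK ord_addr1 // i1 addSnnS.
Qed.

(* k doublings of x_1 + 1 bring the image of [Binv k x] under [bakerR] to x. *)
Lemma baker_run k x : 0 <= x 0 0 < 1 ->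
  let y := \col_i (if i == 0 then (x 0 0 + 1) / 2 ^+ k - 1 else x i 0) in
  iter k (@baker R m) y = x /\ rcount k y = 0%N.
Proof.
move=> x01; elim: k => [|k [IH1 IH2]] y.
  split; last by rewrite /rcount big_ord0.
  by apply/colP => i; rewrite mxE expr0; case: eqP => [->|//]; field.
have y0 : y ord0 ord0 < 0.
  rewrite mxE /= subr_lt0 ltr_pdivrMr ?exprn_gt0 // mul1r exprS.
  by have := pow2_ge1 k; lra.
have yE : baker y = \col_i (if i == 0 then (x 0 0 + 1) / 2 ^+ k - 1 else x i 0).
  rewrite /baker y0; apply/colP => i; rewrite !mxE.
  case: eqP => // _; rewrite /= exprS; field; exact: expf_neq0.
rewrite iterSr yE; split=> //.
by rewrite -add1n rcountD /= yE IH2 addn0 /rcount big_ord1 /= leNgt y0.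
Qed.

(** One visit to X_R, then [k] doublings. If x_1 were 1 and [k] positive, the run would meet x_1 =
    0, which is in X_R, one step early. *)
Lemma Binv_iter k x : cube x -> x 0 0 < 1 ->
  iter k.+1 (@baker R m) (Binv k x) = x /\ rcount k.+1 (Binv k x) = 1%N.
Proof.
move=> xc x1; have x01 : 0 <= x 0 0 < 1 by have /andP[-> _] := xc 0.
have y0 : 0 <= Binv k x ord0 ord0 by have /andP[] := Binv_cube k xc ord0.
have yE : baker (Binv k x) =
    \col_i (if i == 0 then (x 0 0 + 1) / 2 ^+ k - 1 else x i 0).
  rewrite /baker ltNge y0; apply/colP => i; rewrite !mxE -[0 : 'I_M]/(ord0).
  case: ifPn => [_|i0].
    by rewrite eqxx /branch exprS; field; exact: expf_neq0.
  rewrite ord_subr1 // subrK; case: eqP => // /(canRL (subrK _)).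
  by rewrite ord_max_addr1 => iE; rewrite iE in i0.
have [run1 run2] := baker_run k x01.
rewrite iterSr yE; split=> //.
by rewrite -add1n rcountD /= yE run2 addn0 /rcount big_ord1 /= y0.
Qed.

Lemma Binvs_iter s x : cube x -> (forall i, x i 0 < 1) -> exists n,
  [/\ iter n (@baker R m) (Binvs s x) = x, rcount n (Binvs s x) = size s &
      (size s <= n)%N].
Proof.
move=> xc x1; suff [n [? ? ? _]] : exists n,
  [/\ iter n (@baker R m) (Binvs s x) = x, rcount n (Binvs s x) = size s,
      (size s <= n)%N & forall i, Binvs s x i 0 < 1] by exists n.
elim: s => [|k s [n [it rc sn lt1]]] /=.
  by exists 0%N; rewrite /rcount big_ord0.
have [it' rc'] := Binv_iter k (Binvs_cube s xc) (lt1 0).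
exists (n + k.+1)%N; split; last 2 first.
- by lia.
- move=> i; rewrite mxE; case: eqP => // _.
  by have /andP[] := branch_itv k (Binvs_cube s xc 0).
- by rewrite iterD it'.
- by rewrite addnC rcountD it' rc' rc.
Qed.

Lemma cube_closed : closed cube.
Proof.
have -> : cube = \bigcap_(i in [set: 'I_M])
    ((fun z : 'cV[R]_M => z i 0) @^-1` `[0, 1]%classic).
  apply/seteqP; split=> z zc i; first by move=> _; rewrite /= in_itv; exact: zc.
  by have := zc i I; rewrite /= in_itv.
apply: closed_bigI => i _; apply: preimage_closed; last exact: interval_closed.
by move=> z _; exact: coord_continuous.
Qed.

Lemma Binvs_fixpoint s : (M <= size s)%N -> exists2 z, cube z & z = Binvs s z.
Proof.
move=> sM; pose f := mkfun_fun (@Binvs_cube s).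
apply: (@banach_fixed_point _ _ cube f); last 2 first.
- exact: cube_closed.
- by exists 0 => i; rewrite mxE lexx ler01.
(* With at least M steps every coordinate is halved at least once, so 1/2 is a contraction constant
   for the sup norm. *)
exists (2^-1)%:nng; split=> /=; first by lra.
move=> [x y] _ /=.
have xy i : `|x i 0 - y i 0| <= `|x - y|.
  rewrite [leRHS]/Num.norm /= mx_normrE.
  have := le_bigmax 0 (fun ij : 'I_M * 'I_1 => `|(x - y) ij.1 ij.2|) (i, 0).
  by rewrite !mxE.
rewrite [leLHS]/Num.norm /= mx_normrE; apply: bigmax_le => [|[i j] _] /=.
  by rewrite mulr_ge0.
rewrite !mxE ord1 (le_trans (Binvs_contract s xy i)) // mulrC ler_wpM2r //.
rewrite -[leRHS]expr1 ler_wiXn2l ?invr_ge0 ?invf_le1 ?ler1n //.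
by rewrite divn_gt0 // (leq_trans sM) ?leq_addr.
Qed.

(** * Transfer from the cube to X *)

Lemma cube_X : cube `<=` @X R m.
Proof. by move=> z zc; split=> [|j _]; [have := zc ord0; lra|exact: zc]. Qed.

Lemma X_bakerR x : X x -> exists2 y, cube y & bakerR y = x.
Proof.
move=> [x0 xj].
exists (\col_i (if i == ord_max then (1 - x 0 0) / 2 else x (i + 1) 0)).
  move=> i; rewrite mxE; case: eqP => [_|/eqP im]; first by lra.
  by apply: xj; apply/eqP => /(congr1 (@nat_of_ord _)); rewrite ord_addr1.
apply/colP => i; rewrite !mxE; case: ifPn => [/eqP ->|i0].
  by rewrite eqxx; field.
rewrite ord_subr1 // subrK; case: eqP => // /(canRL (subrK _)).
by rewrite ord_max_addr1 => iE; rewrite iE in i0.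
Qed.

Lemma baker_N x : N x -> baker x = x.
Proof.
move=> [_ x0]; rewrite /baker x0 ltrN10; apply/colP => i; rewrite mxE.
by case: eqP => // ->; rewrite x0; ring.
Qed.

Lemma cubeNN z : cube z -> ~ N z.
Proof. by move=> /(_ ord0) z0 [_ zN]; move: z0; rewrite zN; lra. Qed.

(** A preimage of [x] in the cube is approximated and pushed forward by [bakerR], whose Lipschitz
    constant is 2. *)
Lemma fix_dense x (e : R) p : X x -> (M <= p)%N -> 2 * 2^-1 ^+ (p %/ M) < e ->
  exists n z, [/\ (0 < n)%N, fix_ n z, rcount n z = p & ball x e z].
Proof.
move=> /X_bakerR[y yc <-] Mp pe; have [s sp sP] := Binvs_dense p yc.
have [|z zc zE] := @Binvs_fixpoint s; first by rewrite sp.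
have z1 i : z i 0 < 1 by rewrite zE Binvs_lt1 // sp (leq_trans Mp) ?leq_addr.
have [n] := Binvs_iter s zc z1; rewrite -zE sp => -[it rc pn].
have n0 : (0 < n)%N by lia.
have z0 : 0 <= z ord0 ord0 by have /andP[] := zc ord0.
exists n, (baker z); split=> //.
- split; last by rewrite -iterSr iterS it.
  split; first exact/baker_X/cube_X.
  (* Points of N are fixed, so the orbit would return to [z] inside N. *)
  move=> zN; apply: (cubeNN zc); rewrite -it -(prednK n0) iterSr.
  by elim: n.-1 => //= k IH; rewrite baker_N.
(* The visits of [z] in n + 1 steps are counted in two ways. *)
- have := rcountD n 1 z; rewrite addnC rcountD it rc => rE.
  by apply/eqP; rewrite -(eqn_add2l (rcount 1 z)) rE addnC.
have zy i : `|z i 0 - y i 0| <= 2^-1 ^+ (p %/ M).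
  rewrite zE (le_trans (sP z zc i)) // ler_wiXn2l ?invr_ge0 ?invf_le1 ?ler1n //.
  by rewrite leq_div2r // leq_addr.
rewrite /baker ltNge z0 /=; split.
  by rewrite (le_lt_trans _ pe) ?mulr_ge0.
move=> i j; rewrite ord1 /ball /= !mxE distrC.
apply: le_lt_trans pe; case: ifP => _.
  have := zy ord_max; rewrite !ler_norml; lra.
have := zy (inord i.-1); rewrite !ler_norml.
have : 0 <= 2^-1 ^+ (p %/ M) :> R by [].
lra.
Qed.

End InverseBranches.

(** * Choice of the number of visits *)

Lemma exists_small (R : realType) (e : R) : 0 < e ->
  exists d, forall k, (d <= k)%N -> 2 * 2^-1 ^+ k < e.
Proof.
move=> e0; exists (Num.bound (2 / e)) => k kd.
rewrite exprVn ltr_pdivrMr ?exprn_gt0 // -ltr_pdivrMl // mulrC.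
exact: upper_nthrootP.
Qed.

Theorem theoremA (R : realType) (m : nat) :
  (forall (n : nat) (x : 'cV[R]_m.+2),
     (1 <= n)%N -> fix_ n x -> hyperbolic_repelling n x) /\
  (dense_in_X (\bigcup_(n in [set n : nat | (1 <= n)%N]) @fixR R m n) /\
   dense_in_X (\bigcup_(n in [set n : nat | (1 <= n)%N]) @fixC R m n)).
Proof.
split=> [n x|]; first exact: fix_hyperbolic_repelling.
split=> x Xx B /nbhs_ballP[e /= /exists_small[d dP] eB].
  have [||n [z [n0 zf rc zB]]] := @fix_dense R m x e (d.+1 * m.+2) Xx.
  - by rewrite leq_pmull.
  - by rewrite mulnK //; apply: dP.
  exists z; split; last exact: eB.
  by exists n => //; split=> //; exact: spec_real rc.
(* The number of visits is now odd and congruent to 1 mod M. *)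
have [||n [z [n0 zf rc zB]]] := @fix_dense R m x e (d.+1.*2 * m.+2).+1 Xx.
- by lia.
- by rewrite -(addn1 (_ * _)) divnMDl // divn_small // addn0; apply: dP; lia.
exists z; split; last exact: eB.
by exists n => //; split=> //; exact: spec_nonreal rc.
Qed.
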